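(* Let $\{(X_t,c_t):t\in T\}$ be a family of pairwise disjoint fuzzy closure spaces. Then their sum $\big(\bigcup_{t\in T}X_t,\oplus c_t\big)$ is ČF$T_1$ if and only if each $(X_t,c_t)$ is ČF$T_1$.
   Context: $I=[0,1]$; a fuzzy (sub)set of a non-empty set $X$ is a map $f:X\to I$, and $I^X$ is the set of all of them, ordered pointwise, with $\vee,\wedge$ pointwise supremum/infimum. $\underline 0$ is the constant $0$ fuzzy set; $1_A$ is the characteristic function of $A\subseteq X$; the complement is $\mathfrak{Co}(f)(x)=1-f(x)$. For $x\in X$ and $0<\lambda\le1$, the fuzzy point $x_\lambda$ has value $\lambda$ at $x$ and $0$ elsewhere; $x_\lambda\in f$ means $x_\lambda\le f$, i.e. $\lambda\le f(x)$. Fuzzy points $x_\lambda,y_\gamma$ are distinct if $x\ne y$. A fuzzy closure space is a pair $(X,c)$ with $X$ a non-empty set and $c:I^X\to I^X$ satisfying $c(\underline 0)=\underline 0$, $f\le c(f)$, and $c(f\vee g)=c(f)\vee c(g)$ for all $f,g\in I^X$ (idempotency is not required). Sum: if the sets $X_t$ are pairwise disjoint, $X=\bigcup_{t\in T}X_t$ and $\oplus c_t(f)=\bigvee_{t\in T}c_t(1_{X_t}\wedge f)$ for $f\in I^X$, where $1_{X_t}\wedge f$ is regarded as a fuzzy subset of $X_t$ and $c_t(\cdot)\in I^{X_t}$ is extended by $0$ to $X$. $(X,c)$ is ČF$T_1$ if for every two distinct fuzzy points $x_\lambda,y_\gamma$ of $X$, both $x_\lambda\in\mathfrak{Co}(c(y_\gamma))$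 and $y_\gamma\in\mathfrak{Co}(c(x_\lambda))$. *)

(* Defs.v *)
From HB Require Import structures.
From mathcomp Require Import all_boot all_order all_algebra.
From mathcomp Require Import boolp classical_sets functions reals.
From mathcomp Require Import interval_inference.

Set Implicit Arguments.
Unset Strict Implicit.
Unset Printing Implicit Defensive.

Import Order.TTheory GRing.Theory Num.Theory.

Local Open Scope classical_set_scope.
Local Open Scope ring_scope.

(* The order [(f <= g)%O] and the binary lattice operations [Order.join],
   [Order.meet] on fuzzy sets are the pointwise ones, from [boolp.FunOrder]. *)
Notation fuzzy_set R X := (X -> {i01 R}).

Definition fuzzy0 (R : realType) (X : Type) : fuzzy_set R X := fun=> 0%:i01.

Arguments fuzzy0 : clear implicits.

Definition fuzzy_indic (R : realType) (X : Type) (A : set X) : fuzzy_set R X :=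
  fun x => if x \in A then 1%:i01 else 0%:i01.

Definition fuzzy_compl (R : realType) (X : Type) (f : fuzzy_set R X) :
    fuzzy_set R X :=
  fun x => (1 - (f x)%:num)%:i01.

(* [l] ranges over [0, 1]; it is a fuzzy point only for [0 < l]. *)
Definition fuzzy_point (R : realType) (X : Type) (x : X) (l : {i01 R}) :
    fuzzy_set R X :=
  fun y => if `[< y = x >] then l else 0%:i01.

Lemma sup_i01_bounds (R : realType) (T : Type) (u : T -> {i01 R}) :
  0 <= sup (range (fun t => (u t)%:num)) <= 1.
Proof.
have [[t _]|T0] := pselect (exists t : T, True); last first.
  suff -> : range (fun t => (u t)%:num) = set0 by rewrite sup0 lexx ler01.
  by rewrite -subset0 => y [t _ _]; apply: T0; exists t.
have ubu : ubound (range (fun t => (u t)%:num)) 1 by move=> _ [s _ <-].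
apply/andP; split; last by apply: ge_sup => //; exists (u t)%:num; exists t.
by apply: (@le_trans _ _ (u t)%:num) => //; apply: ub_le_sup; [exists 1|exists t].
Qed.

(* This is also the supremum for empty T, since [sup set0] is 0. *)
Definition fuzzy_sup (R : realType) (X T : Type) (F : T -> fuzzy_set R X) :
    fuzzy_set R X :=
  fun x => let b := andP (sup_i01_bounds (F^~ x)) in Itv01 (proj1 b) (proj2 b).

Lemma fuzzy_supP (R : realType) (X T : Type) (F : T -> fuzzy_set R X)
    (g : fuzzy_set R X) :
  reflect (forall t, (F t <= g)%O) (fuzzy_sup F <= g)%O.
Proof.
apply: (iffP idP) => [/lefP Fg t|Fg]; apply/lefP => x.
  apply: le_trans (Fg x); rewrite -num_le /=.
  by apply: ub_le_sup; [exists 1 => _ [s _ <-]|exists t].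
rewrite -num_le /=.
have [[t _]|T0] := pselect (exists t : T, True).
  apply: ge_sup; first by exists (F t x)%:num; exists t.
  by move=> _ [s _ <-]; rewrite num_le; have /lefP := Fg s.
suff -> : range (fun t => (F t x)%:num) = set0 by rewrite sup0.
by rewrite -subset0 => y [t _ _]; apply: T0; exists t.
Qed.

Definition is_fuzzy_closure_space (R : realType) (X : Type)
    (c : fuzzy_set R X -> fuzzy_set R X) : Prop :=
  [/\ inhabited X,
      c (fuzzy0 R X) = fuzzy0 R X,
      forall f, (f <= c f)%O &
      forall f g, c (Order.join f g) = Order.join (c f) (c g)].

Definition CFT1 (R : realType) (X : Type)
    (c : fuzzy_set R X -> fuzzy_set R X) : Prop :=
  forall (x y : X) (l m : {i01 R}), 0 < l%:num -> 0 < m%:num -> x <> y ->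
    (fuzzy_point x l <= fuzzy_compl (c (fuzzy_point y m)))%O /\
    (fuzzy_point y m <= fuzzy_compl (c (fuzzy_point x l)))%O.

(* Extension by 0 of a fuzzy set on A to the ambient type, followed by
   restriction to B; it is used below with A `<=` B and with B `<=` A. *)
Definition fuzzy_transfer (R : realType) (U : Type) (A B : set U)
    (f : fuzzy_set R A) : fuzzy_set R B :=
  sigL B ('valL_ (0%:i01 : {i01 R}) f).
Arguments fuzzy_transfer {R U A} B f.

Definition sum_closure (R : realType) (U T : Type) (X : T -> set U)
    (c : forall t, fuzzy_set R (X t) -> fuzzy_set R (X t))
    (f : fuzzy_set R (\bigcup_t X t)) : fuzzy_set R (\bigcup_t X t) :=
  fuzzy_sup (fun t : T =>
    fuzzy_transfer (\bigcup_t X t)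
      (c t (fuzzy_transfer (X t)
        (Order.meet (fuzzy_indic R (set_val @^-1` X t)) f)))).

Lemma fuzzy_transferE (R : realType) (U : Type) (A B : set U)
    (f : fuzzy_set R A) (x : A) (y : B) :
  set_val x = set_val y -> fuzzy_transfer B f y = f x.
Proof.
rewrite /fuzzy_transfer /= oinv_set_val => xy.
suff -> : insub (set_val y) = Some x by [].
by rewrite -xy; exact: valK.
Qed.

Lemma fuzzy_transfer0 (R : realType) (U : Type) (A B : set U)
    (f : fuzzy_set R A) (y : B) :
  ~ A (set_val y) -> fuzzy_transfer B f y = 0%:i01.
Proof.
by move=> nAy; rewrite /fuzzy_transfer /sigL /= oinv_set_val insubN ?notin_setE.
Qed.

(* Main.v *)
(** In both directions one may test the fuzzy points [x_1], so that CFT1 says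
    that the closure of [y_m] vanishes at every [x <> y].  The closure of a
    fuzzy point [y_m] in the sum is its closure in the summand containing [y],
    extended by 0: by disjointness the restrictions of [y_m] to the other
    summands are the zero fuzzy set, which is its own closure. *)
Require Import Defs.
From HB Require Import structures.
From mathcomp Require Import all_boot all_order all_algebra.
From mathcomp Require Import boolp classical_sets functions reals.
From mathcomp Require Import interval_inference.

Local Open Scope classical_set_scope.
Local Open Scope ring_scope.

Import Order.TTheory GRing.Theory Num.Theory.

Lemma i01_ge0 (R : realType) (a : {i01 R}) : (0%:i01 <= a)%O.
Proof. by rewrite -num_le /=. Qed.

Lemma i01_le1 (R : realType) (a : {i01 R}) : (a <= 1%:i01)%O.
Proof. by rewrite -num_le /=. Qed.

Lemma fuzzy_pointE (R : realType) (X : Type) (x : X) (l : {i01 R}) :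
  fuzzy_point x l x = l.
Proof. by rewrite /fuzzy_point asboolT. Qed.

Lemma fuzzy_point_neq (R : realType) (X : Type) (x y : X) (l : {i01 R}) :
  y <> x -> fuzzy_point x l y = 0%:i01.
Proof. by move=> yx; rewrite /fuzzy_point asboolF. Qed.

Lemma fuzzy_point_le (R : realType) (X : Type) (x : X) (l : {i01 R})
    (f : fuzzy_set R X) :
  (fuzzy_point x l <= f)%O <-> (l <= f x)%O.
Proof.
split=> [/lefP/(_ x)|lf]; first by rewrite fuzzy_pointE.
apply/lefP => z; have [->|zx] := pselect (z = x); first by rewrite fuzzy_pointE.
by rewrite fuzzy_point_neq // i01_ge0.
Qed.

(** The height 1 is the strictest test: [1 <= 1 - a] forces [a = 0], while [a = 0] makes the
    complement equal to 1, which dominates every [l]. The second half of [CFT1] is the first with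
    the two points exchanged. *)
Lemma CFT1P (R : realType) (X : Type) (c : fuzzy_set R X -> fuzzy_set R X) :
  CFT1 c <-> forall (x y : X) (m : {i01 R}), 0 < m%:num -> x <> y ->
    c (fuzzy_point y m) x = 0%:i01.
Proof.
split=> [cT1 x y m m0 xy|c0 x y l m l0 m0 xy].
  have [/fuzzy_point_le + _] := cT1 x y 1%:i01 m ltr01 m0 xy.
  rewrite -num_le /= lerBrDr gerDl => cle0.
  by apply/le_anti; rewrite i01_ge0 andbT -num_le.
split; apply/fuzzy_point_le; rewrite /fuzzy_compl -num_le /= c0 //=.
- by rewrite subr0.
- by rewrite subr0.
- by move=> yx; exact: xy.
Qed.

(** The transfer reads values only at points of [B], where the indicator is 1, so the meet does not
    alter them. *)
Lemma fuzzy_transfer_point (R : realType) (U : Type) (A B : set U)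
    (x : A) (y : B) (m : {i01 R}) :
  set_val x = set_val y ->
  fuzzy_transfer B
    (Order.meet (fuzzy_indic R (set_val @^-1` B)) (fuzzy_point x m)) =
  fuzzy_point y m.
Proof.
move=> xy; apply/funext => z.
have [Az|nAz] := pselect (A (set_val z)); last first.
  rewrite fuzzy_transfer0 // fuzzy_point_neq // => zy; apply: nAz.
  by rewrite zy -xy; exact: set_valP.
pose w : A := SigSub (mem_set Az).
have wz : set_val w = set_val z by [].
rewrite (fuzzy_transferE _ wz) meetfE /fuzzy_indic mem_set; last first.
  by rewrite /= wz; exact: set_valP.
rewrite meet_r ?i01_le1 //.
have [zy|zy] := pselect (z = y).
  (* Points of a subtype are equal once their underlying elements of [U] are. *)
  have -> : w = x by apply: val_inj; rewrite -[LHS]/(set_val w) wz zy -xy.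
  by rewrite zy !fuzzy_pointE.
rewrite !fuzzy_point_neq // => wx; apply: zy; apply: val_inj.
by rewrite -[LHS]/(set_val z) -wz wx xy.
Qed.

(** The only point where [fuzzy_point x m] can be nonzero lies outside [B]. *)
Lemma fuzzy_transfer_point_notin (R : realType) (U : Type) (A B : set U)
    (x : A) (m : {i01 R}) :
  ~ B (set_val x) ->
  fuzzy_transfer B
    (Order.meet (fuzzy_indic R (set_val @^-1` B)) (fuzzy_point x m)) =
  fuzzy0 R B.
Proof.
move=> nBx; apply/funext => z.
have [Az|nAz] := pselect (A (set_val z)); last by rewrite fuzzy_transfer0.
pose w : A := SigSub (mem_set Az).
have wz : set_val w = set_val z by [].
rewrite (fuzzy_transferE _ wz) meetfE fuzzy_point_neq.
  by rewrite meet_r ?i01_ge0.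
by move=> wx; apply: nBx; rewrite -wx wz; exact: set_valP.
Qed.

Lemma sum_closure_point (R : realType) (U T : Type) (X : T -> set U)
    (c : forall t : T, fuzzy_set R (X t) -> fuzzy_set R (X t))
    (c0 : forall t : T, c t (fuzzy0 R (X t)) = fuzzy0 R (X t))
    (X_disjoint : trivIset [set: T] X)
    (s : T) (x : \bigcup_t X t) (y : X s) (m : {i01 R}) :
  set_val x = set_val y ->
  sum_closure c (fuzzy_point x m) =
  fuzzy_transfer (\bigcup_t X t) (c s (fuzzy_point y m)).
Proof.
move=> xy; apply/le_anti/andP; split.
  apply/fuzzy_supP => t; have [->|ts] := pselect (t = s).
    by rewrite (fuzzy_transfer_point _ _ _ _ _ _ _ xy).
  (* For [t] other than [s], disjointness keeps [x] out of [X t], so the term of index [t] is the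
     extension of [c t] applied to zero. *)
  rewrite fuzzy_transfer_point_notin; last first.
    move=> Xtx; apply: ts; apply: X_disjoint => //.
    by exists (set_val x); split => //; rewrite xy; exact: set_valP.
  rewrite c0; apply/lefP => z.
  have [Xz|nXz] := pselect (X t (set_val z)).
    by rewrite (@fuzzy_transferE _ _ _ _ _ (SigSub (mem_set Xz))) // i01_ge0.
  by rewrite fuzzy_transfer0 // i01_ge0.
(* Written as the trace of [fuzzy_point x m] on [X s], the fuzzy point at [y] turns the left side
   into the term of index [s], which lies below the supremum. *)
rewrite -(fuzzy_transfer_point _ _ _ _ _ _ _ xy).
exact: (elimT (fuzzy_supP _ _) (lexx _) s).
Qed.

Theorem theorem5p7 (R : realType) (U T : Type) (X : T -> set U)
    (c : forall t : T, fuzzy_set R (X t) -> fuzzy_set R (X t))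
    (c_space : forall t : T, is_fuzzy_closure_space (c t))
    (X_disjoint : trivIset [set: T] X) :
  CFT1 (sum_closure c) <-> forall t : T, CFT1 (c t).
Proof.
have c0 t : c t (fuzzy0 R (X t)) = fuzzy0 R (X t) by case: (c_space t).
have sumE := sum_closure_point _ _ _ _ _ c0 X_disjoint.
split=> [/CFT1P sum0 t|cT1]; apply/CFT1P => x y m m0 xy.
  have XU (z : X t) : (\bigcup_t X t) (set_val z).
    by exists t => //; exact: set_valP.
  pose inU (z : X t) : \bigcup_t X t := SigSub (mem_set (XU z)).
  have := sum0 (inU x) (inU y) m m0.
  rewrite (sumE t (inU y) y) // (@fuzzy_transferE _ _ _ _ _ x) //; apply.
  by move=> /(congr1 set_val) ?; apply: xy; exact: val_inj.
have [t _ Xty] := set_valP y.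
rewrite (sumE t y (SigSub (mem_set Xty))) //.
(* Outside the summand of [y] the value is 0 by extension; inside it, [x] and [y] are distinct
   points of [X t]. *)
have [Xtx|nXtx] := pselect (X t (set_val x)); last exact: fuzzy_transfer0.
rewrite (@fuzzy_transferE _ _ _ _ _ (SigSub (mem_set Xtx))) //.
have /CFT1P := cT1 t; apply => //.
by move=> /(congr1 set_val) /= ?; apply: xy; exact: val_inj.
Qed.
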